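(* Let $G(z)=\sum_{p=0}^{d}z^pA_p+\sum_{j=1}^k w_j(z)E_j$ be an $n\times n$ Hermitian rational matrix polynomial and let $\lambda\in\mathbb{C}\setminus\mathbb{R}$ be such that $\lambda$ is not a pole of $G(z)$ and $w_j(\lambda)\neq0$ for $j=1,\ldots,k$. Suppose that $M:=(G(\lambda))^{-1}$ exists. Define $\Lambda:=[1,\lambda,\ldots,\lambda^d,w_1(\lambda),\ldots,w_k(\lambda)]\in\mathbb{C}^{1\times(d+k+1)}$ and set $$J:=\Lambda^*\Lambda\otimes M^*M,\qquad H_j:=i\left(\Lambda^*e_{j+1}^*\otimes M^*-e_{j+1}\Lambda\otimes M\right),\quad j=0,\ldots,d+k,$$ where $e_{j+1}$ denotes the $(j+1)$th standard unit vector of $\mathbb{R}^{d+k+1}$. Then $$\widehat\lambda_{\max}:=\min_{t_0,\ldots,t_{d+k}\in\mathbb{R}}\lambda_{\max}\left(J+t_0H_0+\cdots+t_{d+k}H_{d+k}\right)$$ is attained for some $(\hat t_0,\ldots,\hat t_{d+k})\in\mathbb{R}^{d+k+1}$, and $\eta^{\mathrm{Herm}}(G,\lambda)\ge\frac{1}{\sqrt{\widehat\lambda_{\max}}}$. Further, if $\widehat\lambda_{\max}$ is a simple eigenvalue of $J+\hat t_0H_0+\cdots+\hat t_{d+k}H_{d+k}$, then $$\eta^{\mathrm{Herm}}(G,\lambda)=\frac{1}{\sqrt{\widehat\lambda_{\max}}}.$$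
   Context: A rational matrix polynomial (RMP) is $G(z)=\sum_{p=0}^d z^pA_p+\sum_{j=1}^k w_j(z)E_j$ with $A_p,E_j\in\mathbb{C}^{n\times n}$ and $w_j(z)=s_j(z)/q_j(z)$, where $s_j,q_j$ are scalar polynomials, $q_j\not\equiv0$. The poles of $G(z)$ are the roots of the $q_j$. $G(z)$ is Hermitian if all $A_p$ and $E_j$ are Hermitian and $\overline{w_j(z)}=w_j(\overline z)$ for $j=1,\ldots,k$ (so $G(z)^*=G(\overline z)$). $\|\cdot\|$ is the spectral norm. For a tuple of $n\times n$ matrices, the tuple norm is $$|||(\Delta A_0,\ldots,\Delta A_d,\Delta E_1,\ldots,\Delta E_k)|||:=\sqrt{\textstyle\sum_{p=0}^d\|\Delta A_p\|^2+\sum_{j=1}^k\|\Delta E_j\|^2}.$$ For $\mathbb{S}\subseteq(\mathbb{C}^{n\times n})^{d+k+1}$ the structured eigenvalue backward error $\eta^{\mathbb{S}}(G,\lambda)$ is the infimum of $|||(\Delta A_0,\ldots,\Delta E_k)|||$ over all $(\Delta A_0,\ldots,\Delta A_d,\Delta E_1,\ldots,\Delta E_k)\in\mathbb{S}$ with $$\det\Big(\sum_{p=0}^d\lambda^p(A_p-\Delta A_p)+\sum_{j=1}^kw_j(\lambda)(E_j-\Delta E_j)\Big)=0.$$ $\eta^{\mathrm{Herm}}(G,\lambda)$ denotes $\eta^{\mathbb{S}}(G,\lambda)$ when $\mathbb{S}$ is the set of all tuples of $n\times n$ Hermitian matrices. $\lambda_{\max}(H)$ is the largest eigenvalue of a Hermitian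 matrix $H$; $\otimes$ is the Kronecker product. *)

(* Defs.v *)
From HB Require Import structures.
From mathcomp Require Import all_boot all_order all_algebra.
From mathcomp Require Import spectral sesquilinear.
From mathcomp Require Import complex mxtens.
From mathcomp Require Import boolp classical_sets reals ereal.

Set Implicit Arguments.
Unset Strict Implicit.
Unset Printing Implicit Defensive.

Import Order.TTheory GRing.Theory Num.Theory Num.Def.
Local Open Scope ring_scope.
Local Open Scope complex_scope.
Local Open Scope sesquilinear_scope.
Local Open Scope classical_set_scope.

Section Norms.
Variable R : realType.
Local Notation C := R[i].

Definition vnorm2 n (x : 'cV[C]_n) : R :=
  Num.sqrt (\sum_(i < n) complex.Re `|x i 0| ^+ 2).

Definition spectral_norm n (A : 'M[C]_n) : R :=
  sup [set vnorm2 (A *m x) | x in [set x : 'cV[C]_n | vnorm2 x = 1]].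

(* Only meaningful when H has a real eigenvalue, e.g. for H Hermitian of
   positive size; the supremum is then over a nonempty finite set. *)
Definition lambda_max n (H : 'M[C]_n) : R :=
  sup [set x : R | eigenvalue H x%:C].

(* Simplicity in the sense of algebraic multiplicity. *)
Definition simple_eigenvalue n (H : 'M[C]_n) (a : C) : Prop :=
  mup a (char_poly H) = 1%N.

End Norms.

Section RationalMatrixPolynomial.
Variables (R : realType) (n d k : nat).
Local Notation C := R[i].

(* Tuples (A_0, ..., A_d, E_1, ..., E_k); the E_j are indexed from 0. *)
Record coefs := Coefs {
  polyc : 'I_d.+1 -> 'M[C]_n;
  ratc : 'I_k -> 'M[C]_n
}.

Record rmp := Rmp {
  rmp_coefs :> coefs;
  wnum : 'I_k -> {poly C};
  wden : 'I_k -> {poly C};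
  wden_neq0 : forall j, wden j != 0
}.

Definition coefs_sub (c c' : coefs) : coefs :=
  Coefs (fun p => polyc c p - polyc c' p) (fun j => ratc c j - ratc c' j).

Definition coefs_norm (c : coefs) : R :=
  Num.sqrt (\sum_(p < d.+1) spectral_norm (polyc c p) ^+ 2
            + \sum_(j < k) spectral_norm (ratc c j) ^+ 2).

Definition coefs_herm : set coefs :=
  [set c | (forall p, polyc c p \is hermsymmx) /\
           (forall j, ratc c j \is hermsymmx)].

Variable G : rmp.

Definition weight (j : 'I_k) (z : C) : C := (wnum G j).[z] / (wden G j).[z].

Definition pole (z : C) : Prop := exists j, root (wden G j) z.

Definition eval_with (c : coefs) (z : C) : 'M[C]_n :=
  \sum_(p < d.+1) z ^+ p *: polyc c p + \sum_(j < k) weight j z *: ratc c j.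

Definition rmp_eval (z : C) : 'M[C]_n := eval_with G z.

(* The symmetry of w_j is an identity of rational functions: it is required
   wherever the given fraction is defined at both z and its conjugate. *)
Definition rmp_hermitian : Prop :=
  coefs_herm G /\
  forall j z, ~~ root (wden G j) z -> ~~ root (wden G j) z^* ->
    (weight j z)^* = weight j z^*.

(* Extended-real infimum, so that it is +oo when no tuple is admissible. *)
Definition backward_error (S : set coefs) (z : C) : \bar R :=
  ereal_inf [set (coefs_norm c)%:E | c in
    S `&` [set c | \det (eval_with (coefs_sub G c) z) = 0]].

Definition backward_error_herm (z : C) : \bar R := backward_error coefs_herm z.

Definition Lambda_row (z : C) : 'rV[C]_(d.+1 + k) :=
  row_mx (\row_(p < d.+1) z ^+ p) (\row_(j < k) weight j z).

Definition J_mx (z : C) : 'M[C]_((d.+1 + k) * n) :=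
  let M := invmx (rmp_eval z) in let L := Lambda_row z in
  (L ^t* *m L) *t (M ^t* *m M).

Definition H_mx (z : C) (j : 'I_(d.+1 + k)) : 'M[C]_((d.+1 + k) * n) :=
  let M := invmx (rmp_eval z) in let L := Lambda_row z in
  let e : 'cV[C]_(d.+1 + k) := delta_mx j 0 in
  'i *: ((L ^t* *m e ^t*) *t (M ^t*) - (e *m L) *t M).

Definition JH_mx (z : C) (t : 'rV[R]_(d.+1 + k)) : 'M[C]_((d.+1 + k) * n) :=
  J_mx z + \sum_(j < d.+1 + k) (t 0 j)%:C *: H_mx z j.

End RationalMatrixPolynomial.

(* Main.v *)
Require Import Defs.
From mathcomp Require Import all_boot all_order all_algebra.
From mathcomp Require Import spectral sesquilinear.
From mathcomp Require Import complex mxtens.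
From mathcomp Require Import boolp classical_sets reals ereal.
From mathcomp Require Import topology normedtype derive.
From mathcomp Require Import ring lra.

(** Write L for the row of scalars 1, lambda, ..., w_k(lambda) and M for the
inverse of G(lambda).  A Hermitian tuple D makes the perturbed matrix singular
exactly when some nonzero x satisfies x = M (sum_j L_j D_j x)
([singular_eval]).  Put v_j := D_j x and stack the v_j in one block vector v of
length (d+1+k) n.  Then x = M (sum_j L_j v_j), so that v* J v = |x|^2, and
v* H_j v = 2 Im (v_j* x), which vanishes because x* D_j x is real.  Hence for
every t

    |x|^2 = v* (J + sum_j t_j H_j) v <= lambda_max(J + sum_j t_j H_j) |v|^2,

and |v|^2 <= |x|^2 sum_j |D_j|^2: this is the lower bound
([perturbation_lower_bound]).  As G is Hermitian, D = A, its own tuple of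
coefficients, is an admissible perturbation, which forces every lambda_max to
be positive.

Conversely, a unit vector v with v* H_j v = 0 for all j and v* J v = mu > 0
gives back x := M (sum_j L_j v_j) with all v_j* x real.  Such a v_j is the image
of x under a Hermitian matrix of spectral norm |v_j| / |x|, a multiple of a
Householder reflection ([least_norm_hermitian]).  The resulting tuple is
admissible with norm at most 1 / sqrt mu ([stationary_perturbation]).

The vector v comes from first-order optimality.  At a minimizing t whose
largest eigenvalue is simple, with unit eigenvector v, the function lambda_max
is differentiable, with derivative v* H_j v in the direction H_j, so all of
these vanish and mu = v* J v is the minimum.
[simple_lambda_max_stationary] proves what is needed of this by a
spectral-gap estimate: if v* H v < 0, a small step along H pushes the whole form
below lambda_max.

A minimizing t exists by compactness ([pencil_min]).  If t is not a multiple of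
L, the combinations sum_j t_j v_j and sum_j L_j v_j can be prescribed
independently, so sum_j t_j H_j has a positive eigenvalue, and lambda_max grows
at least linearly along t because J is positive semidefinite.  A nonzero real t
is a multiple of L only if L is real (its first entry is 1); then G(lambda) and
M are Hermitian, sum_j L_j H_j vanishes, and it suffices to minimize over the t
with first coordinate 0. *)

Set Implicit Arguments.
Unset Strict Implicit.
Unset Printing Implicit Defensive.

Import Order.TTheory GRing.Theory Num.Theory.
Import numFieldNormedType.Exports.
Local Open Scope ring_scope.
Local Open Scope complex_scope.

(** * Hermitian forms on complex column vectors *)

Section HermitianForms.
Variable R : realType.
Local Notation C := R[i].
Local Open Scope sesquilinear_scope.

Lemma conjC_realC (x : R) : (x%:C : C)^*%R = x%:C.
Proof. exact: conjc_real. Qed.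

Definition hdot n (u v : 'cV[C]_n) : C := (u ^t* *m v) 0 0.
(** A real number, so that all inequalities below live in [R]. *)
Definition sqn n (v : 'cV[C]_n) : R := complex.Re (hdot v v).
(** The form v* H v; for Hermitian H the real part loses nothing, and taking it
makes the form real-valued for every H. *)
Definition qf n (H : 'M[C]_n) (v : 'cV[C]_n) : R := complex.Re (hdot v (H *m v)).

Lemma hdotE n (u v : 'cV[C]_n) : hdot u v = \sum_i (u i 0)^* * v i 0.
Proof. by rewrite /hdot mxE; apply: eq_bigr => i _; rewrite !mxE. Qed.

Lemma hdotDr n (u v w : 'cV[C]_n) : hdot u (v + w) = hdot u v + hdot u w.
Proof. by rewrite /hdot mulmxDr mxE. Qed.

Lemma hdotZr n a (u v : 'cV[C]_n) : hdot u (a *: v) = a * hdot u v.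
Proof. by rewrite /hdot -scalemxAr mxE. Qed.

Lemma hdotC n (u v : 'cV[C]_n) : hdot v u = (hdot u v)^*%R.
Proof.
rewrite !hdotE rmorph_sum; apply: eq_bigr => i _.
by rewrite rmorphM /= conjCK mulrC.
Qed.

Lemma hdotDl n (u v w : 'cV[C]_n) : hdot (v + w) u = hdot v u + hdot w u.
Proof. by rewrite [LHS]hdotC hdotDr rmorphD /= -!hdotC. Qed.

Lemma hdotZl n a (u v : 'cV[C]_n) : hdot (a *: v) u = a^* * hdot v u.
Proof. by rewrite [LHS]hdotC hdotZr rmorphM /= -!hdotC. Qed.

Lemma adjmxM m n p (A : 'M[C]_(m, n)) (B : 'M[C]_(n, p)) :
  (A *m B) ^t* = B ^t* *m A ^t*.
Proof. by rewrite trmx_mul map_mxM. Qed.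

Lemma hdot_adj m n (A : 'M[C]_(m, n)) u v :
  hdot u (A *m v) = hdot (A ^t* *m u) v.
Proof. by rewrite /hdot adjmxM trmxCK mulmxA. Qed.

Lemma hermP n (A : 'M[C]_n) : reflect (A ^t* = A) (A \is hermsymmx).
Proof.
apply: (iffP (is_hermitianmxP _ _ _)) => [e|e]; last by rewrite expr0 scale1r e.
by rewrite [in RHS]e expr0 scale1r.
Qed.

Lemma sqnE n (v : 'cV[C]_n) :
  sqn v = \sum_i complex.Re `|v i 0| ^+ 2.
Proof.
rewrite /sqn hdotE raddf_sum; apply: eq_bigr => i _ /=.
case: (v i 0) => a b /=; rewrite sqr_sqrtr ?addr_ge0 ?sqr_ge0//; ring.
Qed.

Lemma sqn_ge0 n (v : 'cV[C]_n) : 0 <= sqn v.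
Proof. by rewrite sqnE sumr_ge0 // => i _; rewrite sqr_ge0. Qed.

Lemma hdot_real n (v : 'cV[C]_n) : hdot v v = (sqn v)%:C.
Proof.
rewrite /sqn hdotE; rewrite raddf_sum rmorph_sum; apply: eq_bigr => i _ /=.
by case: (v i 0) => a b /=; congr (_ +i* _); ring.
Qed.

Lemma sqn_eq0 n (v : 'cV[C]_n) : (sqn v == 0) = (v == 0).
Proof.
apply/eqP/eqP => [|->]; last by rewrite /sqn /hdot mulmx0 mxE.
rewrite sqnE => /eqP; rewrite psumr_eq0 => [/allP e|i _]; last exact: sqr_ge0.
apply/matrixP => i j; rewrite (ord1 j) mxE; apply/eqP.
have := e i (mem_index_enum _); rewrite sqrf_eq0 => /eqP /=.
by move=> /Normc.eq0_normc ->.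
Qed.

Lemma sqn_gt0 n (v : 'cV[C]_n) : (0 < sqn v) = (v != 0).
Proof. by rewrite lt0r sqn_ge0 andbT sqn_eq0. Qed.

Lemma sqnZ n (a : R) (v : 'cV[C]_n) : sqn (a%:C *: v) = a ^+ 2 * sqn v.
Proof.
rewrite /sqn hdotZr hdotZl conjC_realC hdot_real -!rmorphM /=; ring.
Qed.

Lemma vnorm2E n (v : 'cV[C]_n) : vnorm2 v = Num.sqrt (sqn v).
Proof. by rewrite sqnE. Qed.

Lemma qfD n (A B : 'M[C]_n) v : qf (A + B) v = qf A v + qf B v.
Proof. by rewrite /qf mulmxDl hdotDr raddfD. Qed.

Lemma qfZ n (a : R) (A : 'M[C]_n) v : qf (a%:C *: A) v = a * qf A v.
Proof.
rewrite /qf -scalemxAl hdotZr; case: (hdot _ _) => x y /=; ring.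
Qed.

Lemma qf0 n (v : 'cV[C]_n) : qf 0 v = 0.
Proof. by rewrite /qf mul0mx /hdot mulmx0 mxE. Qed.

Lemma qf_sum n I (r : seq I) (F : I -> 'M[C]_n) v :
  qf (\sum_(i <- r) F i) v = \sum_(i <- r) qf (F i) v.
Proof.
elim/big_rec2: _ => [|i x y _ <-]; first exact: qf0.
exact: qfD.
Qed.

Lemma qfN n (A : 'M[C]_n) v : qf (- A) v = - qf A v.
Proof. by rewrite /qf mulNmx -scaleN1r hdotZr mulN1r raddfN. Qed.

Lemma hermmxD n (A B : 'M[C]_n) : A \is hermsymmx -> B \is hermsymmx ->
  A + B \is hermsymmx.
Proof. by move=> /hermP a /hermP b; apply/hermP; rewrite linearD map_mxD a b. Qed.

Lemma hermmxZ n (a : R) (A : 'M[C]_n) : A \is hermsymmx ->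
  a%:C *: A \is hermsymmx.
Proof.
move=> /hermP e; apply/hermP.
by rewrite linearZ map_mxZ e; congr (_ *: _); exact: conjc_real.
Qed.

Lemma hermmxN n (A : 'M[C]_n) : A \is hermsymmx -> - A \is hermsymmx.
Proof. by move=> /hermP e; apply/hermP; rewrite linearN map_mxN e. Qed.

Lemma hermmx0 n : (0 : 'M[C]_n) \is hermsymmx.
Proof. by apply/hermP; rewrite trmx0 map_mx0. Qed.

Lemma hermmx_sum n I (r : seq I) (F : I -> 'M[C]_n) :
  (forall i, F i \is hermsymmx) -> \sum_(i <- r) F i \is hermsymmx.
Proof. by move=> h; elim/big_rec: _ => [|i x _]; [exact: hermmx0|exact: hermmxD]. Qed.

End HermitianForms.

(** * Spectral theorem and the largest eigenvalue *)

Section LargestEigenvalue.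
Variable R : realType.
Local Notation C := R[i].
Local Open Scope sesquilinear_scope.

(** Q and P are inverse to each other, so this is invariance under similarity;
multiplicities of eigenvalues can then be read off the diagonal form. *)
Lemma char_poly_conj n (P Q D : 'M[C]_n) :
  Q *m P = 1%:M -> char_poly (Q *m D *m P) = char_poly D.
Proof.
move=> QP; rewrite /char_poly.
have QP' : map_mx polyC Q *m map_mx polyC P = 1%:M by rewrite -map_mxM QP map_mx1.
have -> : char_poly_mx (Q *m D *m P) =
    map_mx polyC Q *m char_poly_mx D *m map_mx polyC P.
  rewrite /char_poly_mx mulmxBr mulmxBl !map_mxM /= mul_mx_scalar -scalemxAl.
  by rewrite QP' scalemx1.
by rewrite !det_mulmx mulrAC -det_mulmx QP' det1 mul1r.
Qed.

Lemma hermitian_spectral (K : numClosedFieldType) n (H : 'M[K]_n) :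
  H \is hermsymmx -> exists (P : 'M[K]_n) (d : 'rV[K]_n),
    [/\ P ^t* *m P = 1%:M, P *m P ^t* = 1%:M,
        forall i, d 0 i \is Num.real & H = P ^t* *m diag_mx d *m P].
Proof.
move=> hH; have hu := spectral_unitarymx H.
exists (spectralmx H), (spectral_diag H); split.
- by rewrite -invmx_unitary// mulVmx// unitarymx_unit.
- exact/unitarymxP.
- by move=> i; exact: (mxOverP (hermitian_spectral_diag_real hH)).
- by rewrite -invmx_unitary//; exact/orthomx_spectralP/hermitian_normalmx.
Qed.

Lemma hermitian_diag n (H : 'M[C]_n) : H \is hermsymmx ->
  exists (P : 'M[C]_n) (d : 'I_n -> R),
    [/\ P ^t* *m P = 1%:M, P *m P ^t* = 1%:M &
        H = P ^t* *m diag_mx (\row_i (d i)%:C) *m P].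
Proof.
move=> /hermitian_spectral[P [d [PP PP' dr HE]]].
have dE : \row_i (complex.Re (d 0 i))%:C = d by apply/rowP => i; rewrite mxE RRe_real.
by exists P, (fun i => complex.Re (d 0 i)); rewrite dE.
Qed.

Section Diagonalized.
Variables (n : nat) (H P : 'M[C]_n) (d : 'I_n -> R).
Hypotheses (PP : P ^t* *m P = 1%:M) (PP' : P *m P ^t* = 1%:M).
Hypothesis HE : H = P ^t* *m diag_mx (\row_i (d i)%:C) *m P.

Lemma diag_sqn v : sqn v = \sum_i complex.Re `|(P *m v) i 0| ^+ 2.
Proof. by rewrite -sqnE /sqn hdot_adj mulmxA PP mul1mx. Qed.

Lemma diag_qf v : qf H v = \sum_i d i * complex.Re `|(P *m v) i 0| ^+ 2.
Proof.
rewrite /qf HE -!mulmxA hdot_adj trmxCK hdotE raddf_sum; apply: eq_bigr => i _ /=.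
rewrite mul_diag_mx !mxE.
move: (\sum_j _) => [a b] /=; rewrite sqr_sqrtr ?addr_ge0 ?sqr_ge0//; ring.
Qed.

Lemma diag_char_poly : char_poly H = \prod_i ('X - (d i)%:C%:P).
Proof.
rewrite HE char_poly_conj// char_poly_trig.
  by apply: eq_bigr => i _; rewrite !mxE eqxx mulr1n.
by apply/is_trig_mxP => i j ij; rewrite !mxE -val_eqE ltn_eqF.
Qed.

Lemma diag_eigenvalue x : eigenvalue H x%:C <-> exists i, x = d i.
Proof.
rewrite eigenvalue_root_char diag_char_poly /root horner_prod prodf_seq_eq0.
split=> [/hasP[i _]|[i ->]].
  by rewrite /= hornerXsubC subr_eq0 => /eqP[->]; exists i.
by apply/hasP; exists i; rewrite ?mem_index_enum//= hornerXsubC subrr.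
Qed.

(** The columns of P* are the orthonormal eigenvectors. *)
Definition diag_vec i : 'cV[C]_n := P ^t* *m delta_mx i 0.

Lemma diag_vec_sqn i : sqn (diag_vec i) = 1.
Proof.
rewrite /sqn /diag_vec hdot_adj mulmxA trmxCK PP' mul1mx hdotE.
rewrite (bigD1 i)//= big1 => [|j ji]; rewrite !mxE ?eqxx.
  by rewrite conjC1 mulr1 addr0.
by rewrite (negPf ji) mulr0.
Qed.

Lemma diag_vec_eigen i : H *m diag_vec i = (d i)%:C *: diag_vec i.
Proof.
rewrite /diag_vec HE -!mulmxA [P *m (_ *m _)]mulmxA PP' mul1mx scalemxAr.
congr (_ *m _); rewrite mul_diag_mx; apply/matrixP => k l; rewrite !mxE.
by case: eqP => [->|]; rewrite ?mulr0.
Qed.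

Lemma diag_vec_hdot i v : hdot (diag_vec i) v = (P *m v) i 0.
Proof.
rewrite /diag_vec -[LHS](_ : hdot (delta_mx i 0) (P *m v) = _); last first.
  by rewrite hdot_adj.
rewrite hdotE (bigD1 i)//= big1 => [|j ji]; rewrite !mxE ?eqxx.
  by rewrite conjC1 mul1r addr0.
by rewrite (negPf ji) conjC0 mul0r.
Qed.

(** The real eigenvalues form the finite set of the d_i, so the supremum that
defines [lambda_max] is attained. *)
Lemma diag_lambda_max : (0 < n)%N ->
  exists2 i0, lambda_max H = d i0 & forall i, d i <= d i0.
Proof.
move=> n0; pose i1 := Ordinal n0.
pose i0 := [arg max_(i > i1) d i]%O.
have mx i : d i <= d i0.
  by rewrite /i0; case: arg_maxP => // j _; exact.
exists i0 => //; apply/eqP; rewrite eq_le; apply/andP; split.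
  apply: ge_sup.
    by exists (d i0) => /=; apply/diag_eigenvalue; exists i0.
  by move=> x /= /diag_eigenvalue[i ->].
apply: sup_upper_bound; last by apply/diag_eigenvalue; exists i0.
split; first by exists (d i0) => /=; apply/diag_eigenvalue; exists i0.
by exists (d i0) => x /= /diag_eigenvalue[i ->].
Qed.
End Diagonalized.

Lemma qf_le_lambda_max n (H : 'M[C]_n) v :
  (0 < n)%N -> H \is hermsymmx -> qf H v <= lambda_max H * sqn v.
Proof.
move=> n0 /hermitian_diag[P [d [PP PP' HE]]].
have [i0 -> hi] := diag_lambda_max PP HE n0.
rewrite (diag_qf HE) (diag_sqn PP) mulr_sumr; apply: ler_sum => i _.
by rewrite ler_wpM2r// sqr_ge0.
Qed.

Lemma qf_le_lambda_max1 n (H : 'M[C]_n) v :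
  (0 < n)%N -> H \is hermsymmx -> sqn v = 1 -> qf H v <= lambda_max H.
Proof.
move=> n0 hH v1; rewrite -[lambda_max H]mulr1 -v1; exact: qf_le_lambda_max.
Qed.

Lemma lambda_max_eigen n (H : 'M[C]_n) : (0 < n)%N -> H \is hermsymmx ->
  exists2 v, sqn v = 1 & H *m v = (lambda_max H)%:C *: v.
Proof.
move=> n0 /hermitian_diag[P [d [PP PP' HE]]].
have [i0 -> hi] := diag_lambda_max PP HE n0.
exists (diag_vec P i0); [exact: diag_vec_sqn|exact: diag_vec_eigen].
Qed.

Lemma qf_eigen n (H : 'M[C]_n) (a : R) v : H *m v = a%:C *: v -> qf H v = a * sqn v.
Proof.
by move=> e; rewrite /qf e hdotZr hdot_real -rmorphM.
Qed.

Lemma qf_unit_eigen n (H : 'M[C]_n) (a : R) v :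
  sqn v = 1 -> H *m v = a%:C *: v -> qf H v = a.
Proof. by move=> v1 /qf_eigen ->; rewrite v1 mulr1. Qed.

Lemma lambda_max_le n (H : 'M[C]_n) c : (0 < n)%N -> H \is hermsymmx ->
  (forall v, sqn v = 1 -> qf H v <= c) -> lambda_max H <= c.
Proof.
move=> n0 hH; have [v v1 /qf_eigen] := lambda_max_eigen n0 hH.
by rewrite v1 mulr1 => <- h; exact: h.
Qed.

(** Algebraic simplicity says that exactly one diagonal entry equals the largest
one; g is the distance to the second largest.  The quantity
|u|^2 - |<v, u>|^2 is the squared norm of the part of u orthogonal to v. *)
Lemma simple_spectral_gap n (H : 'M[C]_n) : (0 < n)%N -> H \is hermsymmx ->
  simple_eigenvalue H (lambda_max H)%:C ->
  exists v (g : R), [/\ sqn v = 1, H *m v = (lambda_max H)%:C *: v, 0 < g &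
    forall u, qf H u <= lambda_max H * sqn u
                 - g * (sqn u - complex.Re `|hdot v u| ^+ 2)].
Proof.
move=> n0 /hermitian_diag[P [d [PP PP' HE]]].
have [i0 -> hi] := diag_lambda_max PP HE n0.
rewrite /simple_eigenvalue (diag_char_poly PP HE).
have -> : \prod_i ('X - (d i)%:C%:P) =
    \prod_(y <- [seq (d i)%:C | i <- index_enum 'I_n]) ('X - y%:P).
  by rewrite big_map.
rewrite mu_prod_XsubC count_map => h.
have lt i : i != i0 -> d i < d i0.
  move=> ii0; rewrite lt_neqAle hi andbT; apply/eqP => e.
  by move: h; rewrite -sum1_count (bigD1 i0)/= ?eqxx// (bigD1 i)/= ?e ?eqxx.
have [g g0 hg] : exists2 g : R, 0 < g & forall i, i != i0 -> d i <= d i0 - g.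
  (* The default 1 serves the case where i0 is the only index. *)
  exists (\big[Num.min/1]_(i < n | i != i0) (d i0 - d i)).
    by apply/lt_bigmin; rewrite ?ltr01// => i /lt; rewrite subr_gt0.
  move=> i ii0; rewrite lerBrDl -lerBrDr.
  exact: (bigmin_le_cond _ (fun i => d i0 - d i)).
exists (diag_vec P i0), g; split => //.
- exact: diag_vec_sqn.
- exact: diag_vec_eigen.
move=> u; rewrite diag_vec_hdot (diag_qf HE) (diag_sqn PP).
rewrite (bigD1 i0)//= [X in _ - g * (X - _)](bigD1 i0)//= addrAC subrr add0r.
rewrite [X in _ <= _ * X - _](bigD1 i0)//= mulrDr -addrA lerD2l.
rewrite -mulrBl mulr_sumr; apply: ler_sum => i /hg h1.
by rewrite ler_wpM2r ?sqr_ge0.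
Qed.
End LargestEigenvalue.

(** * Stationarity at a simple largest eigenvalue *)

Section Stationarity.
Variable R : realType.
Local Notation C := R[i].
Local Open Scope sesquilinear_scope.

Lemma sqnZC n (a : C) (v : 'cV[C]_n) :
  sqn (a *: v) = complex.Re `|a| ^+ 2 * sqn v.
Proof.
rewrite /sqn hdotZr hdotZl hdot_real.
case: a => x y /=; rewrite sqr_sqrtr ?addr_ge0 ?sqr_ge0//; ring.
Qed.

Lemma mulC_conj (z : C) : z * z^*%R = (complex.Re `|z| ^+ 2)%:C.
Proof. by rewrite -normCK -{1}[`|z|]RRe_real ?normr_real// -rmorphXn. Qed.

Lemma sqnD n (u v : 'cV[C]_n) :
  sqn (u + v) = sqn u + 2 * complex.Re (hdot u v) + sqn v.
Proof.
rewrite /sqn !(hdotDr, hdotDl) [hdot v u]hdotC !raddfD /=.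
by case: (hdot u v) => x y /=; ring.
Qed.

Lemma hdotBl n (u v w : 'cV[C]_n) : hdot (v - w) u = hdot v u - hdot w u.
Proof. by rewrite hdotDl -scaleN1r hdotZl conjCN1 mulN1r. Qed.

Lemma sqnB n (u v : 'cV[C]_n) :
  sqn (u - v) = sqn u - 2 * complex.Re (hdot u v) + sqn v.
Proof.
rewrite sqnD -scaleN1r hdotZr sqnZC normrN1 mulN1r.
by rewrite raddfN mulrN /= expr1n mul1r.
Qed.

Lemma ReJ (z : C) : complex.Re z^*%R = complex.Re z.
Proof. by case: z. Qed.

Lemma qf_vecD n (H : 'M[C]_n) u v : H \is hermsymmx ->
  qf H (u + v) = qf H u + 2 * complex.Re (hdot (H *m u) v) + qf H v.
Proof.
move=> /hermP hH; rewrite /qf mulmxDr !(hdotDr, hdotDl) [hdot v (H *m u)]hdotC.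
rewrite [hdot u (H *m v)]hdot_adj hH !raddfD /= ReJ.
by rewrite mulr2n !mulrDl !mul1r !addrA.
Qed.

(** The hypothesis is the expansion of |v - e u|^2 >= 0 with p = |u|^2,
q = |v|^2 and r = Re <u, v>. *)
Lemma weighted_young (e p q r : R) : 0 < e ->
  0 <= (- e) ^+ 2 * p + 2 * (- e * r) + q -> 2 * r <= e * p + e^-1 * q.
Proof.
move=> e0 h; rewrite -(ler_pM2l e0) mulrDr [e * (e^-1 * _)]mulrA divff ?gt_eqF//.
rewrite mul1r; lra.
Qed.

(** Here a and W are the squared norms of the components of u along and across v,
h = v* H v, x is twice the cross term and y the form on the transverse part.
The weight e is small enough for the cross term to cost at most half of h. *)
Lemma cross_term_absorbed (h a b e l x y W : R) : 0 < e -> 0 <= a ->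
  e * b <= - h / 2 -> x <= e * (a * b) + e^-1 * W -> y <= l * W ->
  a * h + x + y <= h / 2 * a + (l + e^-1) * W.
Proof.
move=> e0 a0 eb hx hy; have : a * (e * b) <= a * (- h / 2) by rewrite ler_wpM2l.
lra.
Qed.

Lemma young_weight_bound (h b : R) : 0 <= b -> h < 0 -> - h / (2 * (b + 1)) * b <= - h / 2.
Proof.
move=> b0 h0; rewrite mulrAC ler_pdivrMr ?mulr_gt0 ?ltr_wpDl//; lra.
Qed.

(** With step s = g / (2 c), the transverse loss g (1 - a) of the gap pays for the
transverse gain s c (1 - a) of the perturbation with half to spare; what is left
is negative, through the gap if a < 1 and through the slope h if a = 1. *)
Lemma gap_beats_slope (l k s q h c g a : R) : 0 < s -> 0 < g -> 0 <= a -> a <= 1 ->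
  h < 0 -> s * c = g / 2 -> k <= l * 1 - g * (1 - a) ->
  q <= h / 2 * a + c * (1 - a) -> k + s * q < l.
Proof.
move=> s0 g0 a0 a1 h0 sc hk hq.
have h4 : s * q <= s * (h / 2 * a) + g / 2 * (1 - a).
  by rewrite -sc -[s * c * _]mulrA -mulrDr ler_pM2l.
have [a2|a2] := ltP a 1.
  have h5 : s * (h / 2 * a) <= 0.
    by rewrite pmulr_rle0// mulr_le0_ge0// ltW// pmulr_llt0.
  have h6 : 0 < g * (1 - a) by rewrite mulr_gt0// subr_gt0.
  lra.
have ae : a = 1 by apply: le_anti; rewrite a1 a2.
have h5 : s * (h / 2 * a) < 0 by rewrite ae mulr1 pmulr_rlt0// pmulr_llt0.
move: hk h4 h5; rewrite ae; lra.
Qed.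

Lemma hdot_young n (u v : 'cV[C]_n) (e : R) : 0 < e ->
  2 * complex.Re (hdot u v) <= e * sqn u + e^-1 * sqn v.
Proof.
move=> e0; have := sqn_ge0 ((- e)%:C *: u + v).
rewrite sqnD sqnZ hdotZl conjC_realC.
have -> : complex.Re ((- e)%:C * hdot u v) = - e * complex.Re (hdot u v).
  by case: (hdot u v) => x y /=; ring.
exact: weighted_young.
Qed.

(** Split u into its component along v and an orthogonal remainder w.  The cross
term is absorbed by Young's inequality: half of the negative value on v
survives, at the price of a large constant on w. *)
Lemma qf_negative_direction n (H : 'M[C]_n) (v : 'cV[C]_n) : (0 < n)%N -> H \is hermsymmx ->
  sqn v = 1 -> qf H v < 0 ->
  exists2 c : R, 0 < c & forall u, let a := complex.Re `|hdot v u| ^+ 2 in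
    qf H u <= qf H v / 2 * a + c * (sqn u - a).
Proof.
move=> n0 hH v1 hv; set h := qf H v; set b := sqn (H *m v).
have b0 : 0 <= b by exact: sqn_ge0.
pose e := - h / (2 * (b + 1)).
have e0 : 0 < e by rewrite divr_gt0 ?oppr_gt0// mulr_gt0// ltr_wpDl.
exists (`|lambda_max H| + e^-1).
  by rewrite ltr_wpDl ?invr_gt0.
move=> u /=; set z := hdot v u; set a := _ ^+ 2.
pose w := u - z *: v.
have uE : u = z *: v + w by rewrite addrC subrK.
have vw : hdot v w = 0.
  by rewrite /w -scaleNr hdotDr hdotZr hdot_real v1 -/z mulr1 subrr.
have su : sqn u = a + sqn w.
  by rewrite {1}uE sqnD sqnZC v1 mulr1 hdotZl vw mulr0 /= mulr0 addr0.
have qzv : qf H (z *: v) = a * h.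
  rewrite /qf -scalemxAr hdotZr hdotZl /h /qf /a.
  case: (hdot v (H *m v)) => p q; case: (z) => x y /=.
  rewrite sqr_sqrtr ?addr_ge0 ?sqr_ge0//; ring.
rewrite {1}uE qf_vecD// qzv su [a + _]addrC addrK.
have := hdot_young (H *m (z *: v)) w e0.
rewrite -scalemxAr sqnZC -/a -/b => hy.
have hw : qf H w <= `|lambda_max H| * sqn w.
  apply: le_trans (qf_le_lambda_max w n0 hH) _.
  by rewrite ler_wpM2r ?sqn_ge0// ler_norm.
have eb : e * b <= - h / 2 by exact: young_weight_bound.
have a0 : 0 <= a by exact: sqr_ge0.
exact: cross_term_absorbed eb hy hw.
Qed.

(** If v* H v were negative, a small step along H would lower the form everywhere:
near v by the negative slope, away from v by the spectral gap.  Apply this to H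
and to - H. *)
Lemma simple_lambda_max_stationary n (K : 'M[C]_n) : (0 < n)%N -> K \is hermsymmx ->
  simple_eigenvalue K (lambda_max K)%:C ->
  exists v, [/\ sqn v = 1, K *m v = (lambda_max K)%:C *: v &
    forall H, H \is hermsymmx ->
      (forall s : R, lambda_max K <= lambda_max (K + s%:C *: H)) -> qf H v = 0].
Proof.
move=> n0 hK /(simple_spectral_gap n0 hK)[v [g [v1 Kv g0 gap]]].
exists v; split => //.
have nneg H : H \is hermsymmx ->
    (forall s : R, lambda_max K <= lambda_max (K + s%:C *: H)) -> 0 <= qf H v.
  move=> hH hs; rewrite leNgt; apply/negP => hv.
  have [c c0 hc] := qf_negative_direction n0 hH v1 hv.
  pose s := g / (2 * c).
  have s0 : 0 < s by rewrite divr_gt0// mulr_gt0.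
  have sc : s * c = g / 2.
    by rewrite /s; field; rewrite gt_eqF.
  have hKH : K + s%:C *: H \is hermsymmx by exact: (hermmxD hK (hermmxZ s hH)).
  have [u u1 /qf_eigen] := lambda_max_eigen n0 hKH.
  rewrite u1 mulr1 qfD qfZ => e.
  have := hs s; rewrite -e; apply/negP; rewrite -ltNge.
  have := gap u; have := hc u; rewrite /= u1.
  set a := _ ^+ 2 => h1 h2.
  have a0 : 0 <= a by exact: sqr_ge0.
  have := sqn_ge0 (u - hdot v u *: v).
  rewrite -scaleNr sqnD sqnZC v1 u1 hdotZr [hdot u v]hdotC normrN -/a => h3.
  (* Bessel's inequality, from the norm of the part of u orthogonal to v. *)
  have a1 : a <= 1.
    have aE : complex.Re (- (a%:C : C)) = - a by [].
    by move: h3; rewrite mulNr mulC_conj -/a aE; clear; clearbody a; lra.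
  exact: gap_beats_slope sc h2 h1.
move=> H hH hs; apply/eqP; rewrite eq_le (nneg _ hH hs) andbT -oppr_ge0 -qfN.
apply: nneg => [|s].
  exact: hermmxN.
have -> : s%:C *: - H = (- s)%:C *: H by rewrite rmorphN scaleNr scalerN.
exact: hs.
Qed.
End Stationarity.

(** * Hermitian maps of least spectral norm with a prescribed value *)

Section LeastNorm.
Variable R : realType.
Local Notation C := R[i].
Local Open Scope sesquilinear_scope.

(** Reflection exchanging x and y when they have equal norms and real inner
product.  For x = y the convention 2 / 0 = 0 turns it into the identity, which
is the right map in that case as well. *)
Definition householder n (x y : 'cV[C]_n) : 'M[C]_n :=
  1%:M - (2 / sqn (x - y))%:C *: ((x - y) *m (x - y) ^t*).

Lemma householder_herm n (x y : 'cV[C]_n) : householder x y \is hermsymmx.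
Proof.
apply/hermP; rewrite /householder linearB map_mxB /= trmx1 map_mx1; congr (_ - _).
by rewrite linearZ map_mxZ /= adjmxM trmxCK conjC_realC.
Qed.

Lemma rank1_mul n (w u : 'cV[C]_n) : w *m w ^t* *m u = hdot w u *: w.
Proof. by rewrite -mulmxA [_ *m u]mx11_scalar mul_mx_scalar. Qed.

Lemma householder_mul n (x y : 'cV[C]_n) : sqn x = sqn y ->
  complex.Im (hdot x y) = 0 -> householder x y *m x = y.
Proof.
move=> exy im; rewrite /householder mulmxBl mul1mx -scalemxAl rank1_mul scalerA.
have [w0|w0] := eqVneq (sqn (x - y)) 0.
  by rewrite w0 invr0 mulr0 mul0r scale0r subr0; apply/eqP; rewrite -subr_eq0 -sqn_eq0 w0 eqxx.
(* |x - y|^2 = 2 (|x|^2 - <x, y>) since |x| = |y| and <x, y> is real. *)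
have -> : (2 / sqn (x - y))%:C * hdot (x - y) x = 1.
  have -> : hdot (x - y) x = (sqn (x - y) / 2)%:C.
    rewrite sqnB -exy hdotBl hdot_real [hdot y x]hdotC.
    move: im; case: (hdot x y) => a b /= ->.
    by apply/eqP; rewrite eq_complex /=; apply/andP; split; apply/eqP; field.
  by rewrite -rmorphM; have -> : 2 / sqn (x - y) * (sqn (x - y) / 2) = 1 by field.
by rewrite scale1r opprB addrC subrK.
Qed.

Lemma householder_sqn n (x y u : 'cV[C]_n) : sqn (householder x y *m u) = sqn u.
Proof.
rewrite /householder mulmxBl mul1mx -scalemxAl rank1_mul scalerA.
set w := x - y; have [w0|w0] := eqVneq (sqn w) 0.
  by rewrite w0 invr0 mulr0 mul0r scale0r subr0.
rewrite -scaleNr sqnD sqnZC hdotZr [hdot u w]hdotC.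
case: (hdot w u) => a b /=; rewrite sqr_sqrtr ?addr_ge0 ?sqr_ge0//.
by field.
Qed.

Lemma unit_vector n : (0 < n)%N -> exists x : 'cV[C]_n, vnorm2 x = 1.
Proof.
move=> n0; have [v v1 _] := lambda_max_eigen n0 (hermmx0 R n).
by exists v; rewrite vnorm2E v1 sqrtr1.
Qed.

(** The form of A* A is bounded on unit vectors by its largest eigenvalue; this
makes the supremum in [spectral_norm] a genuine one. *)
Lemma spectral_norm_has_sup n (A : 'M[C]_n) : (0 < n)%N ->
  has_sup [set vnorm2 (A *m x) | x in [set x : 'cV[C]_n | vnorm2 x = 1]].
Proof.
move=> n0; split.
  by have [x x1] := unit_vector n0; exists (vnorm2 (A *m x)), x.
exists (Num.sqrt (lambda_max (A ^t* *m A))) => _ [x /= x1 <-].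
rewrite vnorm2E ler_wsqrtr//.
have -> : sqn (A *m x) = qf (A ^t* *m A) x by rewrite /sqn hdot_adj mulmxA /qf hdotC hdot_adj ReJ.
have hA : A ^t* *m A \is hermsymmx by apply/hermP; rewrite adjmxM trmxCK.
apply: le_trans (qf_le_lambda_max x n0 hA) _.
by rewrite -[sqn x]sqr_sqrtr ?sqn_ge0// -vnorm2E x1 expr1n mulr1.
Qed.

Lemma spectral_norm_le n (A : 'M[C]_n) (c : R) : (0 < n)%N -> 0 <= c ->
  (forall x, sqn (A *m x) <= c ^+ 2 * sqn x) -> spectral_norm A <= c.
Proof.
move=> n0 c0 h; apply: ge_sup; first by case: (spectral_norm_has_sup A n0).
move=> _ [x /= x1 <-]; rewrite vnorm2E -(ger0_norm c0) -sqrtr_sqr ler_wsqrtr//.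
by apply: le_trans (h x) _; rewrite -[sqn x]sqr_sqrtr ?sqn_ge0// -vnorm2E x1 expr1n mulr1.
Qed.

Lemma spectral_norm_ge0 n (A : 'M[C]_n) : (0 < n)%N -> 0 <= spectral_norm A.
Proof.
move=> n0; have [x x1] := unit_vector n0.
apply: le_trans (sqrtr_ge0 (sqn (A *m x))) _; rewrite -vnorm2E.
by apply: sup_upper_bound; [exact: spectral_norm_has_sup|exists x].
Qed.

Lemma sqn_le_spectral_norm n (A : 'M[C]_n) (x : 'cV[C]_n) : (0 < n)%N ->
  sqn (A *m x) <= spectral_norm A ^+ 2 * sqn x.
Proof.
move=> n0; have [->|x0] := eqVneq x 0.
  by rewrite mulmx0 (eqP (_ : sqn 0 == 0)) ?sqn_eq0// mulr0.
have sx : 0 < sqn x by rewrite sqn_gt0.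
set c := Num.sqrt (sqn x); have c0 : 0 < c by rewrite sqrtr_gt0.
have c2 : c ^+ 2 = sqn x by rewrite sqr_sqrtr// ltW.
have h : vnorm2 (A *m (c^-1%:C *: x)) <= spectral_norm A.
  apply: sup_upper_bound; first exact: spectral_norm_has_sup.
  exists (c^-1%:C *: x) => //=.
  by rewrite vnorm2E sqnZ -c2 exprVn mulVf ?sqrtr1// expf_neq0// gt_eqF.
move: h; rewrite -(@ler_sqr _ (vnorm2 _)) ?nnegrE ?spectral_norm_ge0 ?sqrtr_ge0//.
rewrite vnorm2E sqr_sqrtr ?sqn_ge0// -scalemxAr sqnZ exprVn c2.
by rewrite ler_pdivrMl// mulrC.
Qed.

(** D is |y| / |x| times the reflection that takes x to the rescaling of y of norm
|x|.  Every matrix taking x to y has norm at least |y| / |x|, so this is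
optimal. *)
Lemma least_norm_hermitian n (x y : 'cV[C]_n) : (0 < n)%N -> x != 0 ->
  complex.Im (hdot x y) = 0 ->
  exists D : 'M[C]_n, [/\ D \is hermsymmx, D *m x = y &
    spectral_norm D ^+ 2 * sqn x <= sqn y].
Proof.
move=> n0 x0 im.
pose c := Num.sqrt (sqn y / sqn x).
have sx : 0 < sqn x by rewrite sqn_gt0.
have c2 : c ^+ 2 = sqn y / sqn x.
  by rewrite /c sqr_sqrtr// divr_ge0 ?sqn_ge0.
have c2x : c ^+ 2 * sqn x = sqn y by rewrite c2 divfK// gt_eqF.
exists (c%:C *: householder x (c^-1%:C *: y)); split.
- by rewrite hermmxZ// householder_herm.
- have [c0|c0] := eqVneq c 0.
    rewrite c0 rmorph0 scale0r mul0mx; apply/esym/eqP.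
    by rewrite -sqn_eq0 -c2x c0 expr0n mul0r.
  rewrite -scalemxAl householder_mul.
  + by rewrite scalerA -rmorphM divff// scale1r.
  + by rewrite sqnZ -c2x exprVn mulKf// expf_neq0.
  + by rewrite hdotZr; move: im; case: (hdot x y) => a b /= ->; rewrite mulr0 mul0r addr0.
- rewrite -c2x ler_pM2r// ler_sqr ?nnegrE ?spectral_norm_ge0 ?sqrtr_ge0//.
  apply: spectral_norm_le => //; first exact: sqrtr_ge0.
  by move=> u; rewrite -scalemxAl sqnZ householder_sqn.
Qed.
End LeastNorm.

(** * Kronecker products acting on blocks *)

Section Blocks.
Variable R : realType.
Local Notation C := R[i].
Local Open Scope sesquilinear_scope.

(** Block j of v is the column j: a vector of the tensor product is handled as an
n x m matrix, on which a Kronecker product acts by multiplication on both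
sides. *)
Definition blk m n (v : 'cV[C]_(m * n)) : 'M[C]_(n, m) :=
  \matrix_(i, j) v (mxtens_index (j, i)) 0.

Definition unblk m n (V : 'M[C]_(n, m)) : 'cV[C]_(m * n) :=
  \col_k V (mxtens_unindex k).2 (mxtens_unindex k).1.

Lemma unblkK m n : cancel (@unblk m n) (@blk m n).
Proof. by move=> V; apply/matrixP => i j; rewrite !mxE mxtens_indexK. Qed.

Lemma sum_mxtens m n (F : 'I_(m * n) -> C) :
  \sum_k F k = \sum_(j < m) \sum_(i < n) F (mxtens_index (j, i)).
Proof.
rewrite pair_bigA (reindex (@mxtens_index m n))/=.
  by apply: eq_bigr => -[].
exists (@mxtens_unindex m n) => k _; [exact: mxtens_indexK|exact: mxtens_unindexK].
Qed.

Lemma blk_tens m n (A : 'M[C]_m) (B : 'M[C]_n) v :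
  blk ((A *t B) *m v) = B *m blk v *m A^T.
Proof.
apply/matrixP => i j; rewrite !mxE sum_mxtens; apply: eq_bigr => l _.
rewrite !mxE mulr_suml; apply: eq_bigr => k _.
by rewrite tensmxE !mxE; ring.
Qed.

Lemma hdot_blk m n (u v : 'cV[C]_(m * n)) :
  hdot u v = \sum_j hdot (col j (blk u)) (col j (blk v)).
Proof.
rewrite hdotE sum_mxtens; apply: eq_bigr => j _.
by rewrite hdotE; apply: eq_bigr => i _; rewrite !mxE.
Qed.

Lemma hdot_blk_tr m n (u v : 'cV[C]_(m * n)) :
  hdot u v = \tr ((blk u) ^t* *m blk v).
Proof.
rewrite hdot_blk; apply: eq_bigr => j _.
by rewrite hdotE !mxE; apply: eq_bigr => i _; rewrite !mxE.
Qed.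

Lemma sqn_blk m n (v : 'cV[C]_(m * n)) : sqn v = \sum_j sqn (col j (blk v)).
Proof. by rewrite /sqn hdot_blk raddf_sum. Qed.

Lemma conj_adjmx p q (A : 'M[C]_(p, q)) : map_mx Num.conj (A ^t*) = A^T.
Proof. by apply/matrixP => i j; rewrite !mxE conjCK. Qed.

(** The first factors of the matrices J and H_j all have rank one; this reduces
their forms to inner products of two combinations of the blocks. *)
Lemma hdot_tens1 m n (a : 'cV[C]_m) (b : 'rV[C]_m) (B : 'M[C]_n) u v :
  hdot u (((a *m b) *t B) *m v) =
  hdot (blk u *m map_mx Num.conj a) (B *m (blk v *m b^T)).
Proof.
rewrite hdot_blk_tr blk_tens trmx_mul !mulmxA mxtrace_mulC !mulmxA.
rewrite /hdot adjmxM.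
rewrite (_ : (map_mx Num.conj a) ^t* = a^T); last first.
  by rewrite map_trmx conj_adjmx.
by rewrite trace_mx11 !mulmxA.
Qed.

Section Pencil.
Variables (m n : nat) (L : 'rV[C]_m) (M : 'M[C]_n).

(** [pJ], [pH] and [pJH] are the matrices J, H_j and J + sum_j t_j H_j for an
arbitrary row L and an arbitrary matrix M. *)
Definition pJ : 'M[C]_(m * n) := (L ^t* *m L) *t (M ^t* *m M).
Definition pH (j : 'I_m) : 'M[C]_(m * n) :=
  let e : 'cV[C]_m := delta_mx j 0 in
  'i *: ((L ^t* *m e ^t*) *t (M ^t*) - (e *m L) *t M).
Definition pJH (t : 'rV[R]_m) : 'M[C]_(m * n) :=
  pJ + \sum_(j < m) (t 0 j)%:C *: pH j.

Definition blkcomb (a : 'rV[C]_m) (v : 'cV[C]_(m * n)) : 'cV[C]_n := blk v *m a^T.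

Lemma adj_tens p q (A : 'M[C]_p) (B : 'M[C]_q) : (A *t B) ^t* = A ^t* *t B ^t*.
Proof. by rewrite trmx_tens map_mxT. Qed.

Lemma pJ_herm : pJ \is hermsymmx.
Proof. by apply/hermP; rewrite adj_tens !adjmxM !trmxCK. Qed.

Lemma pH_herm j : pH j \is hermsymmx.
Proof.
apply/hermP; rewrite /pH linearZ map_mxZ /= linearB map_mxB /= !adj_tens !adjmxM !trmxCK.
rewrite -[in RHS]opprB scalerN -scaleNr; congr (_ *: _).
by rewrite ?complexiE conjCi.
Qed.

Lemma qf_pJ v : qf pJ v = sqn (M *m blkcomb L v).
Proof.
by rewrite /qf hdot_tens1 conj_adjmx -mulmxA hdot_adj trmxCK.
Qed.

Lemma qf_pH j v :
  qf (pH j) v = 2 * complex.Im (hdot (col j (blk v)) (M *m blkcomb L v)).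
Proof.
rewrite /qf -scalemxAl mulmxBl hdotZr -scaleN1r hdotDr hdotZr.
rewrite !hdot_tens1 hdot_adj trmxCK.
have -> : (L ^t*) ^ (@Num.conj C) = L^T by apply/matrixP => i k; rewrite !mxE conjCK.
have e1 : ((delta_mx j 0 : 'cV[C]_m) ^t*)^T = delta_mx j 0.
  by apply/matrixP => i k; rewrite !mxE; case: eqP; case: eqP; rewrite ?conjC1 ?conjC0.
have e2 : (delta_mx j 0 : 'cV[C]_m) ^ (@Num.conj C) = delta_mx j 0.
  by apply/matrixP => i k; rewrite !mxE; case: eqP; case: eqP; rewrite ?conjC1 ?conjC0.
rewrite e1 e2 -colE [hdot (M *m _) _]hdotC /blkcomb.
rewrite -complexiE; case: (hdot _ _) => x y /=; ring.
Qed.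

Definition cplx (t : 'rV[R]_m) : 'rV[C]_m := map_mx (real_complex R) t.

Lemma blkcomb_sum a (v : 'cV[C]_(m * n)) :
  blkcomb a v = \sum_j a 0 j *: col j (blk v).
Proof.
apply/matrixP => i k; rewrite (ord1 k) !mxE summxE; apply: eq_bigr => j _.
by rewrite !mxE mulrC.
Qed.

Lemma qf_pencil (t : 'rV[R]_m) v :
  qf (\sum_(j < m) (t 0 j)%:C *: pH j) v =
  2 * complex.Im (hdot (blkcomb (cplx t) v) (M *m blkcomb L v)).
Proof.
rewrite qf_sum; set w := M *m _.
have -> : blkcomb (cplx t) v = \sum_j (t 0 j)%:C *: col j (blk v).
  by rewrite blkcomb_sum; apply: eq_bigr => j _; rewrite !mxE.
have -> : hdot (\sum_j (t 0 j)%:C *: col j (blk v)) w =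
    \sum_j (t 0 j)%:C * hdot (col j (blk v)) w.
  elim/big_rec2: _ => [|j x y _ <-].
    by rewrite /hdot trmx0 map_mx0 mul0mx mxE.
  by rewrite hdotDl hdotZl conjC_realC.
rewrite raddf_sum mulr_sumr; apply: eq_bigr => j _ /=.
rewrite qfZ qf_pH -/w; case: (hdot _ _) => x y /=; ring.
Qed.

Lemma pJH_herm t : pJH t \is hermsymmx.
Proof.
apply: (hermmxD pJ_herm); apply: hermmx_sum => j; exact: (hermmxZ _ (pH_herm j)).
Qed.

Lemma qf_pJH t v : qf (pJH t) v = sqn (M *m blkcomb L v) +
  2 * complex.Im (hdot (blkcomb (cplx t) v) (M *m blkcomb L v)).
Proof. by rewrite qfD qf_pJ qf_pencil. Qed.

End Pencil.
End Blocks.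

(** * Minimizing a coercive function on a closed cone *)

Section Coercive.
Variable R : realType.
Local Notation C := R[i].
Local Open Scope sesquilinear_scope.
Local Open Scope classical_set_scope.

Lemma closed_preimage (T : topologicalType) (f : T -> R) (D : set R) :
  continuous f -> closed D -> closed (f @^-1` D).
Proof. by move=> cf; apply: preimage_closed => x _; exact: cf. Qed.

Lemma rV_coord_le m (t : 'rV[R]_m) j : `|t 0 j| <= `|t|.
Proof.
by rewrite [leRHS]/Num.norm /= mx_normrE; apply/bigmax_geP; right; exists (0, j).
Qed.

(** The one-sided bound suffices because s and t can be exchanged. *)
Lemma lipschitz_rV_continuous m (F : 'rV[R]_m -> R) (c : R) :
  (forall s t, F t <= F s + c * `|t - s|) -> continuous F.
Proof.
move=> h s; apply/(@cvgrPdist_le _ _ _ (nbhs s) (nbhs_filter s) F) => e e0.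
near=> t.
have ts : `|c| * `|s - t| <= e.
  have : `|s - t| <= e / (`|c| + 1).
    near: t; apply: (@cvgr_dist_le _ _ _ _ _ id) => //.
    by rewrite divr_gt0// ltr_wpDl.
  rewrite ler_pdivlMr ?ltr_wpDl// mulrDr mulr1 mulrC => /(le_trans _); apply.
  by rewrite lerDl.
have cc : c * `|s - t| <= `|c| * `|s - t| by rewrite ler_wpM2r// ler_norm.
rewrite ler_norml; have := h s t; have := h t s.
rewrite [`|t - s|]distrC => h1 h2; apply/andP; split.
  by move: h2 cc ts; clear; lra.
by move: h1 cc ts; clear; lra.
Unshelve. all: by end_near.
Qed.

(** On the unit sphere of the cone T, h has a positive minimum c; by homogeneity
F t >= h t >= c |t| on T, so F can only be small on a bounded part of T. *)
Lemma coercive_min m (T : set 'rV[R]_m) (F h : 'rV[R]_m -> R) :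
  closed T -> T 0 -> (forall (s : R) t, T t -> T (s *: t)) ->
  continuous F -> continuous h ->
  (forall (s : R) t, 0 <= s -> s * h t <= h (s *: t)) ->
  (forall t, T t -> t != 0 -> 0 < h t) ->
  (forall t, h t <= F t) ->
  exists2 t0, T t0 & forall t, T t -> F t0 <= F t.
Proof.
move=> clT T0 scT cF ch hom pos hF.
have clN (r : R) : closed [set t : 'rV[R]_m | `|t| <= r].
  exact: (@closed_preimage _ (fun t : 'rV[R]_m => `|t|) [set x | x <= r] (@norm_continuous _ _) (@closed_le _ r)).
have cptT (D : set 'rV[R]_m) (r : R) : closed D -> (forall t, D t -> `|t| <= r) -> compact D.
  move=> cD Dr; apply: bounded_closed_compact => //.
  exists r; split; first exact: num_real.
  by move=> x rx t /Dr /le_trans; apply; exact: ltW.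
pose S := T `&` [set t | `|t| = 1].
have clS : closed S.
  apply: closedI => //.
  exact: (@closed_preimage _ (fun t : 'rV[R]_m => `|t|) [set x | x = 1] (@norm_continuous _ _) (@closed_eq _ 1)).
have [c c0 hc] : exists2 c : R, 0 < c & forall t, T t -> c * `|t| <= h t.
  have nz t : T t -> t != 0 -> S (`|t|^-1 *: t).
    move=> Tt t0; split; first exact: scT.
    by rewrite /= normrZ normfV normr_id mulVf// normr_eq0.
  have h0 : 0 <= h 0 by have := hom 0 0 (lexx _); rewrite mul0r scale0r.
  have [S0|/set0P S0] := eqVneq S set0.
    (* Then T = {0} and any constant will do. *)
    exists 1 => // t Tt; have [->|t0] := eqVneq t 0; first by rewrite normr0 mulr0.
    by have := nz t Tt t0; rewrite S0.
  have cptS : compact S by apply: (cptT _ 1) => // t [_ ->].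
  have [u uS hu] := EVT_min_rV S0 cptS (continuous_subspaceT ch).
  rewrite inE in uS; have [Tu u1] := uS.
  exists (h u).
    by apply: pos => //; rewrite -normr_eq0 u1 oner_eq0.
  move=> t Tt; have [->|t0] := eqVneq t 0; first by rewrite normr0 mulr0.
  have := hom `|t| (`|t|^-1 *: t) (normr_ge0 _).
  rewrite scalerA divff ?normr_eq0// scale1r => /(le_trans _); apply.
  by rewrite mulrC ler_wpM2l// hu// inE; exact: nz.
pose K := T `&` [set t | `|t| <= F 0 / c].
have F0 : 0 <= F 0.
  by apply: le_trans (hF 0); have := hc 0 T0; rewrite normr0 mulr0.
have K0 : K 0 by split => //=; rewrite normr0 divr_ge0// ltW.
have cptK : compact K.
  by apply: (cptT _ (F 0 / c)) => [|t [_ //]]; exact: closedI.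
have [u uK hu] := EVT_min_rV (ex_intro _ _ K0) cptK (continuous_subspaceT cF).
rewrite inE in uK; have [Tu u1] := uK.
exists u => // t Tt; have [tK|tK] := leP `|t| (F 0 / c).
  by apply: hu; rewrite inE; split.
apply: (le_trans (hu 0 _)); first by rewrite inE.
apply: le_trans (hF t); apply: le_trans (hc t Tt).
by move: tK; rewrite ltr_pdivrMr// mulrC => /ltW.
Qed.

(** As a maximum of the affine functions t |-> v* (K + sum_j t_j H_j) v over unit
vectors, it is Lipschitz, with constant the sum of bounds of the forms of the
H_j. *)
Lemma lambda_max_affine_continuous N m (K : 'M[C]_N) (H : 'I_m -> 'M[C]_N) :
  (0 < N)%N -> K \is hermsymmx -> (forall j, H j \is hermsymmx) ->
  continuous (fun t : 'rV[R]_m => lambda_max (K + \sum_j (t 0 j)%:C *: H j)).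
Proof.
move=> N0 hK hH.
have hP (t : 'rV[R]_m) : K + \sum_j (t 0 j)%:C *: H j \is hermsymmx.
  by apply: (hermmxD hK); apply: hermmx_sum => j; exact: (hermmxZ _ (hH j)).
pose c j := `|lambda_max (H j)| + `|lambda_max (- H j)|.
have c0 j : 0 <= c j by rewrite addr_ge0.
have hc j v : sqn v = 1 -> `|qf (H j) v| <= c j.
  move=> v1; have h1 := qf_le_lambda_max1 N0 (hermmxN (hH j)) v1.
  have h2 := qf_le_lambda_max1 N0 (hH j) v1; rewrite qfN in h1.
  rewrite ler_norml lerNl /c; apply/andP; split.
    by rewrite (le_trans h1)// (le_trans (ler_norm _))// lerDr.
  by rewrite (le_trans h2)// (le_trans (ler_norm _))// lerDl.
apply: (@lipschitz_rV_continuous _ _ (\sum_j c j)) => s t.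
apply: lambda_max_le => // v v1.
have -> : K + \sum_j (t 0 j)%:C *: H j =
   (K + \sum_j (s 0 j)%:C *: H j) + \sum_j ((t - s) 0 j)%:C *: H j.
  rewrite -addrA; congr (_ + _); rewrite -big_split; apply: eq_bigr => j _ /=.
  by rewrite -scalerDl -rmorphD !mxE [s 0 j + _]addrC subrK.
rewrite qfD; apply: lerD.
  exact: qf_le_lambda_max1.
rewrite qf_sum mulr_suml; apply: ler_sum => j _; rewrite qfZ.
apply: le_trans (ler_norm _) _; rewrite normrM mulrC.
by apply: ler_pM => //; [exact: hc|exact: rV_coord_le].
Qed.
End Coercive.

(** * Existence of a minimizing parameter *)

Section Minimizer.
Variable R : realType.
Local Notation C := R[i].
Local Open Scope sesquilinear_scope.
Local Open Scope classical_set_scope.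

(** [j0] is the position of the entry 1 of L, and [Mherm] is how the Hermitian
character of G enters: when L is real, G(lambda) is a real combination of
Hermitian matrices. *)
Section Slice.
Variables (m n : nat) (j0 : 'I_m) (L : 'rV[C]_m) (M : 'M[C]_n).
Hypotheses (n_gt0 : (0 < n)%N) (L0 : L 0 j0 = 1) (Mu : M \in unitmx).
Hypothesis Mherm : (forall j, L 0 j \is Num.real) -> M \is hermsymmx.

Let N_gt0 : (0 < m * n)%N.
Proof. by rewrite muln_gt0 n_gt0 andbT; case: (m) j0 => [[]|]. Qed.

(** Changing one block at a time lets a block vector with prescribed combinations
be built from two nonzero blocks. *)
Lemma blkcomb_delta a j (x : 'cV[C]_n) (V : 'M[C]_(n, m)) :
  blkcomb a (unblk (V + x *m delta_mx 0 j)) = blkcomb a (unblk V) + a 0 j *: x.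
Proof.
rewrite /blkcomb !unblkK mulmxDl; congr (_ + _).
rewrite -mulmxA [delta_mx _ _ *m _]mx11_scalar mul_mx_scalar; congr (_ *: _).
rewrite mxE (bigD1 j)//= big1 => [|i /negPf ij]; rewrite !mxE ?eqxx ?ij.
  by rewrite mul1r addr0.
by rewrite mul0r.
Qed.

(** Cramer's rule for the system with matrix ((a, c), (1, b)). *)
Lemma solve_two_by_two (a b c : C) (y z : 'cV[C]_n) : a * b - c != 0 ->
  let u := (a * b - c)^-1 *: (b *: y - c *: z) in
  let v := (a * b - c)^-1 *: (a *: z - y) in
  a *: u + c *: v = y /\ u + b *: v = z.
Proof.
by move=> d0 /=; split; apply/matrixP => i j; rewrite !mxE; field.
Qed.

(** Independence of t and L gives a nonzero 2 x 2 minor through the column [j0],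
so two blocks suffice to prescribe sum_j t_j v_j = y and sum_j L_j v_j = z.
The choice y = - i w, z = M^-1 w makes the form equal to 2 Im <y, w> = 2 |w|^2. *)
Lemma pencil_positive (t : 'rV[R]_m) :
  cplx t != (t 0 j0)%:C *: L ->
  0 < lambda_max (\sum_j (t 0 j)%:C *: pH L M j).
Proof.
move=> tL.
have [j dj] : exists j, (t 0 j0)%:C * L 0 j - (t 0 j)%:C != 0.
  apply/existsP; apply: contraNT tL; rewrite negb_exists => /forallP h.
  apply/eqP/rowP => j; rewrite !mxE.
  by have := h j; rewrite negbK subr_eq0 => /eqP ->.
set dl := _ - _ in dj.
have [w w1 _] := lambda_max_eigen n_gt0 (hermmx0 R n).
pose y : 'cV[C]_n := (- 'i) *: w; pose z := invmx M *m w.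
pose V := 0 + (dl^-1 *: (L 0 j *: y - (t 0 j)%:C *: z)) *m delta_mx 0 j0
  + (dl^-1 *: ((t 0 j0)%:C *: z - y)) *m delta_mx 0 j.
pose v := unblk V.
have cL : blkcomb L v = z.
  rewrite /v !blkcomb_delta {1}/blkcomb unblkK mul0mx add0r L0 scale1r.
  by case: (solve_two_by_two y z dj).
have ct : blkcomb (cplx t) v = y.
  rewrite /v !blkcomb_delta {1}/blkcomb unblkK mul0mx add0r !mxE.
  by case: (solve_two_by_two y z dj).
have hP : \sum_j (t 0 j)%:C *: pH L M j \is hermsymmx.
  by apply: hermmx_sum => i; exact: (hermmxZ _ (pH_herm _ _ i)).
have q2 : qf (\sum_j (t 0 j)%:C *: pH L M j) v = 2.
  rewrite qf_pencil cL ct /z mulmxA mulmxV// mul1mx /y hdotZl hdot_real w1.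
  by rewrite -?complexiE /=; ring.
have := qf_le_lambda_max v N_gt0 hP; rewrite q2 => h.
have := lt_le_trans (ltr0n R 2) h.
by rewrite pmulr_lgt0// sqn_gt0; apply: contraTneq h => ->;
  rewrite (eqP (_ : sqn 0 == 0)) ?sqn_eq0// mulr0 -ltNge.
Qed.

(** Coercivity holds on the cone T of parameters with t_j0 = 0 when L is real, and
on all parameters otherwise.  In the real case t and t - t_j0 L give the same
form, because <w, M w> is real for Hermitian M, so T meets every class. *)
Lemma pencil_min : exists t0, forall t,
  lambda_max (pJH L M t0) <= lambda_max (pJH L M t).
Proof.
pose T : set 'rV[R]_m := [set t | (forall j, L 0 j \is Num.real) -> t 0 j0 = 0].
have [t0 _ h] : exists2 t0, T t0 &
    forall t, T t -> lambda_max (pJH L M t0) <= lambda_max (pJH L M t).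
  apply: (@coercive_min _ _ T _ (fun t => lambda_max (0 + \sum_j (t 0 j)%:C *: pH L M j))).
  - have [rL|rL] := pselect (forall j, L 0 j \is Num.real).
      rewrite (_ : T = [set t | t 0 j0 = 0]); last first.
        by apply/seteqP; split => t /=; [exact|move=> ? _].
      exact: (@closed_preimage _ _ (fun t : 'rV[R]_m => t 0 j0) [set x | x = 0]
        (@coord_continuous _ _ _ _ _) (@closed_eq _ 0)).
    rewrite (_ : T = setT); first exact: closedT.
    by apply/seteqP; split => t // _ /rL.
  - by move=> _; rewrite mxE.
  - by move=> s t Tt rL; rewrite mxE (Tt rL) mulr0.
  - apply: lambda_max_affine_continuous => //; [exact: pJ_herm|exact: pH_herm].
  - apply: lambda_max_affine_continuous => //; [exact: hermmx0|exact: pH_herm].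
  - move=> s t s0; rewrite !add0r.
    have hP u : \sum_j ((u : 'rV[R]_m) 0 j)%:C *: pH L M j \is hermsymmx.
      by apply: hermmx_sum => i; exact: (hermmxZ _ (pH_herm _ _ i)).
    have [v v1 /qf_eigen] := lambda_max_eigen N_gt0 (hP t).
    rewrite v1 mulr1 => <-.
    have := qf_le_lambda_max1 N_gt0 (hP (s *: t)) v1.
    rewrite (_ : \sum_j ((s *: t) 0 j)%:C *: pH L M j =
       s%:C *: \sum_j (t 0 j)%:C *: pH L M j) ?qfZ//.
    rewrite scaler_sumr; apply: eq_bigr => j _.
    by rewrite mxE rmorphM scalerA.
  - move=> t Tt t0; rewrite add0r; apply: pencil_positive.
    apply: contra_neq t0 => tL.
    (* A relation t = t_j0 L with t_j0 <> 0 would make L real. *)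
    have [t00|t00] := eqVneq (t 0 j0) 0.
      move: tL; rewrite t00 scale0r => /rowP tL.
      by apply/rowP => j; have := tL j; rewrite !mxE => -[].
    case/eqP: (t00); apply: Tt => j.
    have e : (t 0 j)%:C = (t 0 j0)%:C * L 0 j.
      by move/rowP: tL => /(_ j); rewrite !mxE.
    have -> : L 0 j = ((t 0 j0)^-1 * t 0 j)%:C.
      by rewrite rmorphM fmorphV /= e mulKf//; apply: contra_neq t00 => -[].
    by apply/complex_realP; eexists.
  - move=> t; rewrite add0r.
    have hP : \sum_j (t 0 j)%:C *: pH L M j \is hermsymmx.
      by apply: hermmx_sum => i; exact: (hermmxZ _ (pH_herm _ _ i)).
    apply: lambda_max_le => // v v1.
    have := qf_le_lambda_max1 N_gt0 (pJH_herm L M t) v1.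
    by apply: le_trans; rewrite qfD lerDr qf_pJ sqn_ge0.
exists t0 => t.
have [rL|rL] := pselect (forall j, L 0 j \is Num.real); last exact: h.
pose Lr : 'rV[R]_m := \row_j complex.Re (L 0 j).
have LrE : cplx Lr = L by apply/rowP => j; rewrite !mxE RRe_real.
pose t' := t - t 0 j0 *: Lr.
apply: (le_trans (h t' _)).
  by move=> _; rewrite !mxE L0 /= mulr1 subrr.
apply: lambda_max_le => //; first exact: pJH_herm.
move=> v v1; have := qf_le_lambda_max1 N_gt0 (pJH_herm L M t) v1.
apply: le_trans; rewrite !qf_pJH lerD2l.
have -> : blkcomb (cplx t') v = blkcomb (cplx t) v - (t 0 j0)%:C *: blkcomb L v.
  rewrite /t' /cplx map_mxB map_mxZ -/(cplx Lr) LrE /blkcomb.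
  by rewrite linearB linearZ /= mulmxBr -scalemxAr.
rewrite hdotBl hdotZl conjC_realC.
have /complex_realP[k ->] : hdot (blkcomb L v) (M *m blkcomb L v) \is Num.real.
  apply/CrealP; rewrite -hdotC hdot_adj.
  by rewrite -[in RHS](hermP _ (Mherm rL)) trmxCK.
by case: (hdot _ _) => a b /=; rewrite mulr0 mul0r addr0 subr0.
Qed.
End Slice.
End Minimizer.

(** * Perturbations and block vectors *)

Section Realizations.
Variable R : realType.
Local Notation C := R[i].

Variables (m n : nat) (L : 'rV[C]_m) (M : 'M[C]_n).
Hypothesis n_gt0 : (0 < n)%N.

Lemma qf_pJH_sum t v :
  qf (pJH L M t) v = qf (pJ L M) v + \sum_j t 0 j * qf (pH L M j) v.
Proof.
by rewrite qfD qf_sum; congr (_ + _); apply: eq_bigr => j _; rewrite qfZ.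
Qed.

Lemma pJH_shift (t : 'rV[R]_m) (s : R) j :
  pJH L M t + s%:C *: pH L M j = pJH L M (t + s *: delta_mx 0 j).
Proof.
rewrite /pJH -addrA; congr (_ + _).
rewrite (bigD1 j)//= [RHS](bigD1 j)//= !mxE !eqxx mulr1 rmorphD scalerDl addrAC.
congr (_ + _); apply: eq_bigr => i /negPf ij.
by rewrite !mxE ij andbF mulr0 addr0.
Qed.

(** The block vector v with blocks D_j x satisfies v* J v = |x|^2 and, as
x* D_j x is real, v* H_j v = 0 for every j; compare its Rayleigh quotient with
lambda_max. *)
Lemma perturbation_lower_bound (D : 'I_m -> 'M[C]_n) (x : 'cV[C]_n) (t : 'rV[R]_m) :
  (0 < m)%N -> (forall j, D j \is hermsymmx) -> x != 0 ->
  x = M *m (\sum_j L 0 j *: (D j *m x)) ->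
  0 < lambda_max (pJH L M t) /\
  1 <= lambda_max (pJH L M t) * \sum_j spectral_norm (D j) ^+ 2.
Proof.
move=> m0 hD x0 xE; set l := lambda_max _.
pose v : 'cV[C]_(m * n) := unblk (\matrix_(i, j) (D j *m x) i 0).
have cv j : col j (blk v) = D j *m x.
  by rewrite /v unblkK; apply/matrixP => i k; rewrite (ord1 k) !mxE.
have Lv : M *m blkcomb L v = x.
  by rewrite blkcomb_sum [RHS]xE; congr (_ *m _); apply: eq_bigr => j _; rewrite cv.
have sx : 0 < sqn x by rewrite sqn_gt0.
have qv : qf (pJH L M t) v = sqn x.
  rewrite qf_pJH_sum qf_pJ Lv big1 ?addr0// => j _.
  rewrite qf_pH cv Lv.
  have /complex_realP[k ->] : hdot (D j *m x) x \is Num.real.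
    by apply/CrealP; rewrite -hdotC hdot_adj (hermP _ (hD j)).
  by rewrite /= !mulr0.
have mn0 : (0 < m * n)%N by rewrite muln_gt0 m0.
have := qf_le_lambda_max v mn0 (pJH_herm L M t); rewrite qv -/l => h.
have l0 : 0 < l.
  rewrite ltNge; apply/negP => l0; have := lt_le_trans sx h.
  by rewrite ltNge mulr_le0_ge0// sqn_ge0.
split=> //; rewrite -(ler_pM2r sx) mul1r -mulrA; apply: (le_trans h).
rewrite ler_pM2l// sqn_blk mulr_suml; apply: ler_sum => j _; rewrite cv.
exact: sqn_le_spectral_norm.
Qed.

(** Reads off x and the blocks v_j from v; stationarity says that v_j* x is real,
which is what a Hermitian matrix taking x to v_j requires. *)
Lemma stationary_perturbation (v : 'cV[C]_(m * n)) : sqn v = 1 ->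
  (forall j, qf (pH L M j) v = 0) -> 0 < qf (pJ L M) v ->
  exists (D : 'I_m -> 'M[C]_n) (x : 'cV[C]_n),
    [/\ forall j, D j \is hermsymmx, x != 0,
        x = M *m (\sum_j L 0 j *: (D j *m x)) &
        \sum_j spectral_norm (D j) ^+ 2 <= (qf (pJ L M) v)^-1].
Proof.
rewrite qf_pJ; set x := M *m _ => v1 st sx.
have x0 : x != 0 by rewrite -sqn_gt0.
have /choice[D hD] : forall j, exists D : 'M[C]_n, [/\ D \is hermsymmx,
    D *m x = col j (blk v) & spectral_norm D ^+ 2 * sqn x <= sqn (col j (blk v))].
  move=> j; apply: least_norm_hermitian => //.
  have := st j; rewrite qf_pH -/x hdotC; case: (hdot _ _) => a b /= e.
  by move: e; lra.
exists D, x; split => //.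
- by move=> j; case: (hD j).
- rewrite {1}/x blkcomb_sum; congr (_ *m _); apply: eq_bigr => j _.
  by case: (hD j) => _ ->.
- rewrite -(ler_pM2r sx) mulVf ?gt_eqF// -v1 sqn_blk mulr_suml.
  by apply: ler_sum => j _; case: (hD j).
Qed.
End Realizations.

(** * Tuples of coefficients as one family *)

Section CoefficientFamily.
Variable R : realType.
Local Notation C := R[i].

Variables (n d k : nat) (G : rmp R n d k).

(** Lists A_0, ..., A_d, E_1, ..., E_k in the order of the entries of
[Lambda_row], so that both kinds of coefficients are treated alike. *)
Definition coef (c : coefs R n d k) (j : 'I_(d.+1 + k)) : 'M[C]_n :=
  match split j with inl p => polyc c p | inr i => ratc c i end.

Definition coefs_of (D : 'I_(d.+1 + k) -> 'M[C]_n) : coefs R n d k :=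
  Coefs (fun p => D (lshift k p)) (fun j => D (rshift d.+1 j)).

Lemma coef_lshift c p : coef c (lshift k p) = polyc c p.
Proof. by rewrite /coef (unsplitK (inl _ p)). Qed.

Lemma coef_rshift c j : coef c (rshift d.+1 j) = ratc c j.
Proof. by rewrite /coef (unsplitK (inr _ j)). Qed.

Lemma coefs_ofK D j : coef (coefs_of D) j = D j.
Proof.
by rewrite -[j]splitK; case: (split j) => i /=; rewrite ?coef_lshift ?coef_rshift.
Qed.

Lemma eval_withE c z :
  eval_with G c z = \sum_j (Lambda_row G z) 0 j *: coef c j.
Proof.
rewrite big_split_ord; congr (_ + _); apply: eq_bigr => j _ /=.
  by rewrite coef_lshift row_mxEl mxE.
by rewrite coef_rshift row_mxEr mxE.
Qed.

Lemma eval_with_mul c z (x : 'cV[C]_n) : eval_with G c z *m x =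
  \sum_j (Lambda_row G z) 0 j *: (coef c j *m x).
Proof.
by rewrite eval_withE mulmx_suml; apply: eq_bigr => j _; rewrite scalemxAl.
Qed.

Lemma eval_with_sub c c' z :
  eval_with G (coefs_sub c c') z = eval_with G c z - eval_with G c' z.
Proof.
rewrite /eval_with /= opprD addrACA -!sumrB.
by congr (_ + _); apply: eq_bigr => j _; rewrite scalerBr.
Qed.

Lemma sum_coef (F : 'M[C]_n -> R) c :
  \sum_j F (coef c j) = \sum_p F (polyc c p) + \sum_j F (ratc c j).
Proof.
rewrite big_split_ord; congr (_ + _); apply: eq_bigr => j _.
  by rewrite coef_lshift.
by rewrite coef_rshift.
Qed.

Lemma coefs_normE c : coefs_norm c = Num.sqrt (\sum_j spectral_norm (coef c j) ^+ 2).
Proof. by rewrite (sum_coef (fun A => spectral_norm A ^+ 2)). Qed.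

Lemma coefs_hermE c : coefs_herm c <-> forall j, coef c j \is hermsymmx.
Proof.
split=> [[h1 h2] j|h].
  by rewrite -[j]splitK; case: (split j) => i /=; rewrite ?coef_lshift ?coef_rshift.
split=> i; first by rewrite -coef_lshift.
by rewrite -coef_rshift.
Qed.

(** A null vector x of G(lambda) - sum_j L_j D_j is a fixed point of
x |-> M (sum_j L_j D_j x). *)
Lemma singular_eval z c : rmp_eval G z \in unitmx ->
  \det (eval_with G (coefs_sub G c) z) = 0 <->
  exists2 x : 'cV[C]_n, x != 0 & x = invmx (rmp_eval G z) *m
     (\sum_j (Lambda_row G z) 0 j *: (coef c j *m x)).
Proof.
move=> hG; rewrite eval_with_sub -/(rmp_eval G z).
split.
  rewrite -det_tr => /eqP/det0P[u u0 /(congr1 trmx)].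
  rewrite trmx_mul trmxK trmx0 mulmxBl [eval_with G c z *m _]eval_with_mul.
  move=> /eqP; rewrite subr_eq0 => /eqP e.
  by exists u^T; [rewrite trmx_eq0|rewrite -e mulKmx].
move=> [x x0 xE]; rewrite -det_tr; apply/eqP/det0P; exists x^T.
  by rewrite trmx_eq0.
rewrite -trmx_mul mulmxBl [eval_with G c z *m _]eval_with_mul {1}xE mulKVmx//.
by rewrite subrr; exact: trmx0.
Qed.
End CoefficientFamily.

(** * The backward error *)

Theorem theorem5p1 (R : realType) (n d k : nat) (hn : (0 < n)%N)
    (G : rmp R n d k) (hG : rmp_hermitian G)
    (lambda : R[i]) (lambda_nonreal : lambda \isn't Num.real)
    (lambda_npole : ~ pole G lambda)
    (w_neq0 : forall j, weight G j lambda != 0)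
    (hM : rmp_eval G lambda \in unitmx) :
  exists lmax_hat : R,
    [/\ exists t_hat, lambda_max (JH_mx G lambda t_hat) = lmax_hat,
        forall t, lmax_hat <= lambda_max (JH_mx G lambda t),
        0 < lmax_hat,
        ((1 / Num.sqrt lmax_hat)%:E <= backward_error_herm G lambda)%E
      & forall t_hat, lambda_max (JH_mx G lambda t_hat) = lmax_hat ->
          simple_eigenvalue (JH_mx G lambda t_hat) lmax_hat%:C ->
          backward_error_herm G lambda = (1 / Num.sqrt lmax_hat)%:E].
Proof.
pose L := Lambda_row G lambda; pose M := invmx (rmp_eval G lambda).
have JHE t : JH_mx G lambda t = pJH L M t by [].
pose j0 : 'I_(d.+1 + k) := lshift k ord0.
have L0 : L 0 j0 = 1 by rewrite /L /j0 row_mxEl mxE expr0.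
have Mu : M \in unitmx by rewrite unitmx_inv.
have hA : forall j, coef G j \is hermsymmx by apply/coefs_hermE; case: hG.
have Mherm : (forall j, L 0 j \is Num.real) -> M \is hermsymmx.
  move=> rL; have /hermP hE : rmp_eval G lambda \is hermsymmx.
    rewrite /rmp_eval eval_withE; apply: hermmx_sum => j.
    have /complex_realP[r ->] := rL j; exact: (hermmxZ _ (hA j)).
  by apply/hermP; rewrite /M trmx_inv map_invmx hE.
have [t0 min0] := pencil_min hn L0 Mu Mherm.
exists (lambda_max (pJH L M t0)).
(* The coefficients of G, being Hermitian, form an admissible perturbation. *)
have lpos : 0 < lambda_max (pJH L M t0).
  have [x x0] : exists x : 'cV[R[i]]_n, x != 0.
    have [x x1] := unit_vector R hn; exists x.
    apply: contra_eq_neq x1 => ->; rewrite vnorm2E (eqP (_ : sqn 0 == 0)) ?sqn_eq0//.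
    by rewrite sqrtr0 eq_sym oner_eq0.
  have xE : x = M *m (\sum_j L 0 j *: (coef G j *m x)).
    by rewrite -eval_with_mul mulKmx.
  by case: (@perturbation_lower_bound _ _ _ L M hn (coef G) x t0 isT hA x0 xE).
have lower c : coefs_herm c -> \det (eval_with G (coefs_sub G c) lambda) = 0 ->
    1 / Num.sqrt (lambda_max (pJH L M t0)) <= coefs_norm c.
  move=> /coefs_hermE hc /singular_eval-/(_ hM)[x x0 xE].
  have [_ h1] := @perturbation_lower_bound _ _ _ L M hn (coef c) x t0 isT hc x0 xE.
  rewrite coefs_normE mul1r -sqrtrV ?(ltW lpos)// ler_wsqrtr//.
  by rewrite -(ler_pM2l lpos) divff ?gt_eqF.
have low : ((1 / Num.sqrt (lambda_max (pJH L M t0)))%:E <= backward_error_herm G lambda)%E.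
  apply: le_ereal_inf_tmp => _ [c [hc dc] <-].
  have := lower c hc dc.
  by rewrite -lee_fin.
split; [by exists t0; rewrite JHE|by move=> t; rewrite JHE; exact: min0|exact: lpos|exact: low|].
move=> t1; rewrite JHE => e1 simp; apply: le_anti; rewrite low andbT.
have mn0 : (0 < (d.+1 + k) * n)%N by rewrite muln_gt0.
rewrite -e1 in simp.
have [v [v1 ev st]] := simple_lambda_max_stationary mn0 (pJH_herm L M t1) simp.
have st' j : qf (pH L M j) v = 0.
  apply: st; first exact: pH_herm.
  by move=> s; rewrite pJH_shift e1; exact: min0.
(* The terms in H_j contribute nothing at v: the value is that of J alone. *)
have qJ : qf (pJ L M) v = lambda_max (pJH L M t0).
  have s0 : \sum_j t1 0 j * qf (pH L M j) v = 0.
    by apply: big1 => j _; rewrite st' mulr0.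
  by rewrite -e1 -(qf_unit_eigen v1 ev) qf_pJH_sum s0 addr0.
have := stationary_perturbation hn v1 st'; rewrite qJ => /(_ lpos)[D [x [hD x0 xE le]]].
apply: (@le_trans _ _ (coefs_norm (coefs_of D))%:E).
  apply: ereal_inf_lbound; exists (coefs_of D); [split|by []].
    by apply/coefs_hermE => j; rewrite coefs_ofK.
  apply/(singular_eval _ hM); exists x; first exact: x0.
  rewrite {1}xE.
  by congr (_ *m _); apply: eq_bigr => j _; rewrite coefs_ofK.
rewrite lee_fin coefs_normE mul1r -sqrtrV; last exact: ltW.
apply: ler_wsqrtr; under eq_bigr do rewrite coefs_ofK.
exact: le.
Qed.
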